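(* Let $u,v\in C_0^+(\mathbb{Z}^d)$ be admissible, $u^*=R_{\mathbb{Z}^d}u$, $v^*=R_{\mathbb{Z}^d}v$. Then $$\sum_{x\in\mathbb{Z}^d}u(x)v(x)\le\sum_{x\in\mathbb{Z}^d}u^*(x)v^*(x).$$ Moreover, if $u\in\mathcal{S}(\mathbb{Z}^d)$ with $\operatorname{ran}u=[a_1>a_2>\cdots]$ and $\sum_{x\in\mathbb{Z}^d}u^*(x)v^*(x)<+\infty$, then equality holds if and only if $v=v^*$.
   Context: $\mathbb{R}_+=[0,\infty)$, $d\ge1$ is an integer, $e_i$ is the $i$-th standard unit vector, $\langle\cdot,\cdot\rangle$ the Euclidean inner product. Sums of nonnegative terms take values in $[0,\infty]$. Admissible functions: $u\in C_0^+(\mathbb{Z}^d)$ means $u:\mathbb{Z}^d\to\mathbb{R}_+$ with $\{u>t\}$ finite for all $t>0$ (similarly on $\mathbb{Z}$ or $\mathbb{Z}+1/2$). The $n$-th largest value of $u$ is $a_n=\sup_{|\Omega|=n}\min_{\Omega}u$, $n\ge1$; $\operatorname{ran}u=[a_1>a_2>\cdots]$ means that $a_n>a_{n+1}$ for all $n\ge1$. One-dimensional rearrangement: for $w$ admissible on $\mathbb{Z}$ or on $\mathbb{Z}+1/2$ with largest values $a_1\ge a_2\ge\cdots$ (with multiplicity), $R_{\mathbb{Z}}w(x)=a_{1-2x}$ if $x\le0$ and $R_{\mathbb{Z}}w(x)=a_{2x}$ if $x>0$. Rearrangement on $\mathbb{Z}^d$: let $\vec E=\{e_i,\frac{e_i+e_j}{2},\frac{e_i-e_j}{2}:1\le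 i<j\le d\}$ (all $e_i$, $1\le i\le d$, included). For $e\in\vec E$, partition $\mathbb{Z}^d$ into the classes of the relation ''$x-y$ is parallel to $e$''; on each class $V$ the map $x\mapsto\langle e,x\rangle$ is a bijection onto $\mathbb{Z}$ or $\mathbb{Z}+1/2$, and the one-step rearrangement $R_eu$ is defined by $(R_eu)|_V=R_{\mathbb{Z}}(u|_V)$ under this identification. Fix an enumeration of $\vec E$ (for $d=2$: $e_1,e_2,\frac{e_1+e_2}{2},\frac{e_1-e_2}{2}$); $R^ku$ is obtained from $u$ by applying successively the first $k$ of the operators $R_e$ in the sequence obtained by repeating this enumeration cyclically. The Schwarz rearrangement is $R_{\mathbb{Z}^d}u(x)=\lim_{k\to\infty}R^ku(x)$, $x\in\mathbb{Z}^d$ (the limit exists). $\mathcal{S}(\mathbb{Z}^d)=\{u\in C_0^+(\mathbb{Z}^d):R_{\mathbb{Z}^d}u=u\}$. *)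

(* Defs.v *)
From HB Require Import structures.
From mathcomp Require Import all_boot all_order all_algebra finmap.
From mathcomp Require Import all_classical all_reals all_analysis.

Set Implicit Arguments.
Unset Strict Implicit.
Unset Printing Implicit Defensive.

Import Order.TTheory GRing.Theory Num.Theory.
Import numFieldNormedType.Exports.

Local Open Scope classical_set_scope.
Local Open Scope ring_scope.

Definition admissible (R : realType) (T : choiceType) (u : T -> R) : Prop :=
  (forall x, 0 <= u x) /\ (forall t, 0 < t -> finite_set [set x | t < u x]).

(* The sup over n-element subsets Omega of D of the minimum of u on Omega; the
   infimum below is a minimum for n >= 1.  Indices start at n = 1. *)
Definition nth_largest (R : realType) (T : choiceType) (D : set T) (u : T -> R)
    (n : nat) : R :=
  sup [set inf (u @` [set` Omega]) |
        Omega in [set Omega : {fset T} |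
                   [set` Omega] `<=` D /\ #|` Omega| = n]].

Definition strictly_decreasing_range (R : realType) (T : choiceType)
    (u : T -> R) : Prop :=
  forall n, (1 <= n)%N -> nth_largest setT u n.+1 < nth_largest setT u n.

(* D is Z or Z + 1/2, seen inside rat, and w is only looked at on D; for s in D
   the argument of Num.truncn is a positive integer. *)
Definition rearr1 (R : realType) (D : set rat) (w : rat -> R) (s : rat) : R :=
  if s <= 0 then nth_largest D w (Num.truncn (1 - 2 * s))
  else nth_largest D w (Num.truncn (2 * s)).

Definition inner (d : nat) (e : 'rV[rat]_d) (x : 'rV[int]_d) : rat :=
  \sum_(i < d) e 0 i * (x 0 i)%:~R.

Definition unit_vec (d : nat) (i : 'I_d) : 'rV[rat]_d := delta_mx 0 i.

Definition directions (d : nat) : set 'rV[rat]_d :=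
  [set e | (exists i : 'I_d, e = unit_vec i) \/
           (exists i j : 'I_d, (i < j)%N /\
              (e = 2^-1 *: (unit_vec i + unit_vec j) \/
               e = 2^-1 *: (unit_vec i - unit_vec j)))].

Arguments directions d : clear implicits.

Definition enumerates_directions (d : nat) (E : seq 'rV[rat]_d) : Prop :=
  uniq E /\ [set` E] = directions d.

Definition parallel_class (d : nat) (e : 'rV[rat]_d) (x : 'rV[int]_d) :
    set 'rV[int]_d :=
  [set y | exists c : rat, map_mx intr (x - y) = c *: e].

(* On the class V of x, u is transported to inner e @` V along the inverse of
   the bijection inner e. *)
Definition rearr_step (R : realType) (d : nat) (e : 'rV[rat]_d)
    (u : 'rV[int]_d -> R) (x : 'rV[int]_d) : R :=
  let V := parallel_class e x in
  rearr1 (inner e @` V) (u \o pinv_ (fun=> 0) V (inner e)) (inner e x).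

Fixpoint rearr_iter (R : realType) (d : nat) (E : seq 'rV[rat]_d) (k : nat)
    (u : 'rV[int]_d -> R) : 'rV[int]_d -> R :=
  if k is k'.+1 then
    rearr_step (nth 0 E (k' %% size E)) (rearr_iter E k' u)
  else u.

Definition schwarz (R : realType) (d : nat) (E : seq 'rV[rat]_d)
    (u : 'rV[int]_d -> R) : 'rV[int]_d -> R :=
  fun x => lim (rearr_iter E k u x @[k --> \oo]).

Definition schwarz_fixed (R : realType) (d : nat) (E : seq 'rV[rat]_d) :
    set ('rV[int]_d -> R) :=
  [set u | admissible u /\ schwarz E u = u].

(* Main.v *)
Require Import Defs.
From HB Require Import structures.
From mathcomp Require Import all_boot all_order all_algebra finmap.
From mathcomp Require Import all_classical all_reals all_analysis.
From mathcomp Require Import lra zify ring.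

Set Implicit Arguments.
Unset Strict Implicit.
Unset Printing Implicit Defensive.

Import Order.TTheory GRing.Theory Num.Theory.
Import numFieldNormedType.Exports.

Local Open Scope classical_set_scope.
Local Open Scope ring_scope.

(** Everything happens on the level sets {u > t}, t > 0, which are finite.  The
    one-step rearrangement acts on them by a compression C: on each line the
    points of A are replaced by as many points of lowest rank, the rank
    enumerating the line outwards from its centre.  Compressions are monotone
    and preserve cardinality, and this alone gives the Hardy-Littlewood
    inequality for sets,
      |A `&` B| = |C (A `&` B)| <= |C A `&` C B|,
    for one compression as well as for any composition of them.

    The iteration converges because a single integer-valued potential decreases
    under all the compressions: energy x = 2 d |x|^2 - tilt x, where the linear
    form tilt is positive on every direction and so small that, on each line,
    the energy is a convex parabola in the coordinate s with centre in the open
    interval from 0 to 1/2; it is thus strictly increasing in the rank.  The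
    total energy of a finite set decreases strictly unless the set is fixed, so
    the iterates of a finite set are eventually constant (iter_seq_stable), and the level sets
    of the Schwarz rearrangement are the final values of the iterates of the
    level sets (schwarz_level).  In particular |{u > s} `&` {v > t}| does not
    exceed |{u* > s} `&` {v* > t}| (schwarz_cardI), and the inequality follows
    by slicing both functions into layers (layer_cake_le).

    For the equality case, suppose that the positive values of u = u* are distinct.  Every
    superlevel set of u is then stable under moving a point of a line to a lower
    rank; such a set contains any given point z as soon as it contains a point
    far enough away (closed_large), and u is positive at infinitely many points,
    so u > 0 everywhere.  If v differs from v*, some level set B of v differs from the
    corresponding level set B' of v*, say at x.  As s decreases through the
    value u x, the set {u > s} gains exactly the point x, so it cannot have the
    same number of points in B as in B' both before and after
    (level_separates).  The inequality |{u > s} `&` B| <= |{u > s} `&` B'| is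
    strict for one s, and remains strict after integration over the layers
    (layer_cake_lt), as level sets do not change when the level is slightly
    increased. *)

(** * Slicing a sum into layers *)

Section LayerCake.
Variables (R : realType).

Lemma staircase_le (eps w : R) (N : nat) : 0 <= eps -> 0 <= w ->
  \sum_(k < N) eps * (k.+1%:R * eps < w)%R%:R <= Num.min w (N%:R * eps).
Proof.
move=> e0 w0; elim: N => [|N IH]; first by rewrite big_ord0 mul0r le_min w0 lexx.
rewrite big_ord_recr /=; move: IH; rewrite !le_min => /andP[h1 h2].
case: ltP => h /=; rewrite ?mulr1 ?mulr0 ?addr0.
  apply/andP; split; last by rewrite -natr1 mulrDl mul1r lerD2r.
  by apply/ltW/(le_lt_trans _ h); rewrite -natr1 mulrDl mul1r lerD2r.
by rewrite h1 /= (le_trans h2)// ler_wpM2r// ler_nat.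
Qed.

(** Strict level tests at the multiples of eps from eps on lose one whole step, hence
    the additive eps; the truncation at N.+1 * eps is harmless because N is
    taken large on a finite set. *)
Lemma le_staircase (eps w : R) (N : nat) : 0 <= eps ->
  Num.min w (N.+1%:R * eps) <=
    eps + \sum_(k < N) eps * (k.+1%:R * eps < w)%R%:R.
Proof.
move=> e0; elim: N => [|N IH]; first by rewrite big_ord0 mul1r addr0 ge_min lexx orbT.
rewrite big_ord_recr /=; case: (ltP (N.+1%:R * eps) w) => h /=; last first.
  by move: IH; rewrite mulr0 addr0 (min_idPl h) => IH; rewrite ge_min IH.
move: IH; rewrite (min_idPr (ltW h)) => IH.
rewrite ge_min; apply/orP; right.
by rewrite mulr1 addrA -[N.+2%:R]natr1 mulrDl mul1r lerD2r.
Qed.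

Lemma esumZl (T : choiceType) (c : R) (a : T -> \bar R) : 0 < c ->
  (forall x, 0 <= a x)%E ->
  (\esum_(x in setT) (c%:E * a x) = c%:E * \esum_(x in setT) a x)%E.
Proof.
move=> c0 a0; rewrite /esum -ereal_sup_pZl//; congr ereal_sup.
apply/seteqP; split=> [_ [F FT <-]|_ [_ [F FT <-] <-]].
  by exists (\sum_(x \in F) a x)%E; [exists F|rewrite ge0_mule_fsumr].
by exists F => //; rewrite ge0_mule_fsumr.
Qed.

(** Layer-cake comparison in one factor.  Sampling the levels at the multiples
    of eps turns w into a finite sum of indicators, to which the hypothesis
    applies term by term; on a finite set F this costs eps times the sum of g
    over F, which is as small as desired.  Working with a finite grid avoids
    any measurability question. *)
Lemma layer_cake_le (T : choiceType) (g w g' w' : T -> R) :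
  (forall x, 0 <= g x) -> (forall x, 0 <= w x) ->
  (forall x, 0 <= g' x) -> (forall x, 0 <= w' x) ->
  (forall t, 0 < t ->
    (\esum_(x in setT) (g x * (t < w x)%R%:R)%:E
       <= \esum_(x in setT) (g' x * (t < w' x)%R%:R)%:E)%E) ->
  (\esum_(x in setT) (g x * w x)%:E <= \esum_(x in setT) (g' x * w' x)%:E)%E.
Proof.
move=> g0 w0 g'0 w'0 H; apply: ge_ereal_sup => _ [F [finF _] <-].
apply/lee_addgt0Pr => eta eta0.
pose G := \sum_(x <- fset_set F) g x.
have G0 : 0 <= G by apply: sumr_ge0.
have [eps e0 epsG] : exists2 eps, 0 < eps & G * eps <= eta.
  have G1 : 0 < G + 1 by rewrite ltr_wpDl.
  exists (eta / (G + 1)); first by rewrite divr_gt0.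
  by rewrite mulrA ler_pdivrMr// mulrC ler_pM2l// lerDl.
have [N HN] : exists N, forall x, x \in fset_set F -> w x <= N.+1%:R * eps.
  pose M := \sum_(x <- fset_set F) w x.
  exists (Num.truncn (M / eps)) => x xF.
  have /ltW := truncnS_gt (M / eps); rewrite ler_pdivrMr//; apply: le_trans.
  by rewrite /M (big_fsetD1 x)//= lerDl sumr_ge0.
rewrite fsbig_finite//= sumEFin.
pose S (f : T -> R) x := \sum_(k < N) eps * (k.+1%:R * eps < f x)%R%:R.
have S0 f x : 0 <= S f x.
  by apply: sumr_ge0 => k _; rewrite mulr_ge0// ltW.
have swap (f h : T -> R) : (forall x, 0 <= f x) ->
    (\esum_(x in setT) (f x * S h x)%:E = \sum_(k < N) \esum_(x in setT)
       (eps%:E * (f x * (k.+1%:R * eps < h x)%R%:R)%:E))%E.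
  move=> f0; rewrite -esum_sum.
    apply: eq_esum => x _; rewrite /S mulr_sumr -sumEFin.
    by apply: eq_bigr => k _; rewrite -EFinM mulrCA.
  by move=> x k _ _; rewrite -EFinM lee_fin !mulr_ge0// ltW.
apply: (@le_trans _ _ (\esum_(x in setT) (g x * S w x)%:E + eta%:E)%E).
  apply: (@le_trans _ _ (\sum_(x <- fset_set F) g x * S w x + eta)%:E).
    rewrite lee_fin; apply: (@le_trans _ _
      (\sum_(x <- fset_set F) g x * (S w x + eps))).
      rewrite big_seq [leRHS]big_seq; apply: ler_sum => x xF.
      apply: ler_wpM2l => //; have := le_staircase (w x) N (ltW e0).
      by rewrite (min_idPl (HN _ xF)) addrC.
    under eq_bigr do rewrite mulrDr.
    by rewrite big_split /= lerD2l -mulr_suml.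
  rewrite EFinD leeD2r// -sumEFin -fsbig_finite//.
  by apply: esum_ge; exists F.
rewrite leeD2r//; apply: (@le_trans _ _ (\esum_(x in setT) (g' x * S w' x)%:E)).
  rewrite !swap//; apply: lee_sum => k _.
  rewrite !esumZl//; first by rewrite lee_pmul2l//; apply: H; rewrite mulr_gt0.
  - by move=> x; rewrite lee_fin mulr_ge0.
  - by move=> x; rewrite lee_fin mulr_ge0.
apply: le_esum => x _; rewrite lee_fin ler_wpM2l//.
by have := staircase_le N (ltW e0) (w'0 x); rewrite le_min => /andP[].
Qed.

(** Strictness at one level t0 is not lost in the integration: by the gap, the
    whole layer between t0 and t0 + delta has the same slices as t0.  Cutting
    this layer out of w and w' leaves functions to which layer_cake_le still
    applies, and the layers themselves contribute delta times a strict
    inequality; finiteness allows the two to be added. *)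
Lemma layer_cake_lt (T : choiceType) (g w g' w' : T -> R) (t0 delta : R) :
  (forall x, 0 <= g x) -> (forall x, 0 <= w x) ->
  (forall x, 0 <= g' x) -> (forall x, 0 <= w' x) ->
  (forall t, 0 < t ->
    (\esum_(x in setT) (g x * (t < w x)%R%:R)%:E
       <= \esum_(x in setT) (g' x * (t < w' x)%R%:R)%:E)%E) ->
  0 < t0 -> 0 < delta ->
  (forall x, t0 < w x -> t0 + delta <= w x) ->
  (forall x, t0 < w' x -> t0 + delta <= w' x) ->
  (\esum_(x in setT) (g x * (t0 < w x)%R%:R)%:E
       < \esum_(x in setT) (g' x * (t0 < w' x)%R%:R)%:E)%E ->
  (\esum_(x in setT) (g' x * w' x)%:E < +oo)%E ->
  (\esum_(x in setT) (g x * w x)%:E < \esum_(x in setT) (g' x * w' x)%:E)%E.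
Proof.
move=> g0 w0 g'0 w'0 H t00 d0 gw gw' lt0 fin.
pose cut (f : T -> R) x := f x - delta * (t0 < f x)%R%:R.
have cut0 (f : T -> R) : (forall x, 0 <= f x) ->
    (forall x, t0 < f x -> t0 + delta <= f x) -> forall x, 0 <= cut f x.
  move=> f0 gf x; rewrite /cut; case: ltP => h /=; last by rewrite mulr0 subr0.
  by have := gf x h; lra.
have cut_lt (f : T -> R) : (forall x, t0 < f x -> t0 + delta <= f x) ->
    forall t x, (t < cut f x) = ((if t < t0 then t else t + delta) < f x).
  move=> gf t x; rewrite /cut.
  have := gf x; case: (ltP t0 (f x)) => /= h; rewrite ?mulr1 ?mulr0.
    by move=> /(_ isT) h'; case: (ltP t t0) => h''; apply/idP/idP => ?; lra.
  by move=> _; case: (ltP t t0) => h''; apply/idP/idP => ?; lra.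
have split (f h : T -> R) : (forall x, 0 <= f x) -> (forall x, 0 <= h x) ->
    (forall x, t0 < h x -> t0 + delta <= h x) ->
    (\esum_(x in setT) (f x * h x)%:E = \esum_(x in setT) (f x * cut h x)%:E +
     \esum_(x in setT) (delta%:E * (f x * (t0 < h x)%R%:R)%:E))%E.
  move=> f0 h0 gh; rewrite -esumD.
  - apply: eq_esum => x _; rewrite -EFinM -EFinD; congr (_%:E).
    by rewrite /cut; ring.
  - by move=> x _; rewrite lee_fin mulr_ge0// cut0.
  - by move=> x _; rewrite -EFinM lee_fin !mulr_ge0// ltW.
have lecut : (\esum_(x in setT) (g x * cut w x)%:E
    <= \esum_(x in setT) (g' x * cut w' x)%:E)%E.
  apply: layer_cake_le => //; [exact: cut0|exact: cut0|move=> t tpos].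
  under eq_esum do rewrite cut_lt//.
  under [leRHS]eq_esum do rewrite cut_lt//.
  by apply: H; case: ifP => // _; rewrite addr_gt0.
move: fin; rewrite (split g w)// (split g' w')// !esumZl//; last 2 first.
- by move=> x; rewrite lee_fin mulr_ge0.
- by move=> x; rewrite lee_fin mulr_ge0.
have cutge : (0 <= \esum_(x in setT) (g' x * cut w' x)%:E)%E.
  by apply: esum_ge0 => x _; rewrite lee_fin mulr_ge0// cut0.
move=> fin; have cutfin : (\esum_(x in setT) (g' x * cut w' x)%:E < +oo)%E.
  apply: le_lt_trans fin; rewrite leeDl// mule_ge0 ?lee_fin ?(ltW d0)//.
  by apply: esum_ge0 => x _; rewrite lee_fin mulr_ge0.
rewrite addeC [ltRHS]addeC; apply: lte_leD => //; last by rewrite lte_pmul2l.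
by rewrite ge0_fin_numE// ?(le_lt_trans lecut)//; apply: esum_ge0 => x _;
  rewrite lee_fin mulr_ge0// cut0.
Qed.
End LayerCake.

(** * Compression of finite sets along ranked classes *)

Section Compress.
Local Open Scope nat_scope.
Local Open Scope fset_scope.
Variables (T : choiceType) (cls : rel T) (rho : T -> nat).

Definition slice (A : {fset T}) (x : T) : {fset T} := [fset y in A | cls x y].

Definition position (A : {fset T}) (x : T) : nat :=
  #|` [fset y in slice A x | rho y <= rho x]|.

(** The default value x is never met for n > 0 when the classes are ranked. *)
Definition point_of_rank (x : T) (n : nat) : T :=
  xget x [set y | cls x y /\ rho y = n]%classic.

(** Defining the compression as an image, moving each point of A to the rank
    equal to its position within A, makes cardinality and total energy
    immediate; in_compress gives the description by initial segments. *)
Definition compress (A : {fset T}) : {fset T} :=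
  [fset point_of_rank x (position A x) | x in A].

(** Each class is enumerated by its ranks 1, 2, 3, and so on. *)
Record ranked_classes : Prop := RankedClasses {
  cls_equiv : equivalence_rel cls;
  rho_gt0 : forall x, 0 < rho x;
  rho_inj : forall x y, cls x y -> rho x = rho y -> x = y;
  rho_surj : forall x n, 0 < n -> exists y, cls x y /\ rho y = n }.

Hypothesis rk : ranked_classes.

Let clsxx x : cls x x. Proof. by have [] := cls_equiv rk x x x. Qed.
Let cls_left x y : cls x y -> cls x =1 cls y.
Proof. by move=> xy z; have [_ /(_ xy)] := cls_equiv rk x y z. Qed.
Let cls_sym x y : cls x y -> cls y x.
Proof. by move=> xy; rewrite -(cls_left xy). Qed.

Lemma slice_eq A x y : cls x y -> slice A x = slice A y.
Proof. by move=> xy; apply/fsetP => z; rewrite !inE (cls_left xy). Qed.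

Lemma in_slice A x y : (y \in slice A x) = (y \in A) && cls x y.
Proof. by rewrite !inE. Qed.

Lemma point_of_rankP x n : 0 < n ->
  cls x (point_of_rank x n) /\ rho (point_of_rank x n) = n.
Proof.
move=> n0; have [y Hy] := rho_surj rk x n0.
exact: (xgetPex x (P := [set y | cls x y /\ rho y = n]%classic) (ex_intro _ y Hy)).
Qed.

Lemma position_gt0 A x : x \in A -> 0 < position A x.
Proof.
by move=> xA; rewrite cardfs_gt0; apply/fset0Pn; exists x; rewrite !inE xA clsxx /=.
Qed.

(** The ranks of the points counted by the position are distinct and lie
    between 1 and rho x: compression never increases the rank. *)
Lemma position_le_rho A x : position A x <= rho x.
Proof.
rewrite /position; set S := [fset _ in _ | _].
have <- : #|` [fset rho y | y in S]| = #|` S|.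
  apply: card_in_imfset => y z; rewrite !inE /= => /andP[/andP[_ xy] _].
  move=> /andP[/andP[_ xz] _]; apply: (rho_inj rk).
  by rewrite -(cls_left xy).
apply: (@leq_trans #|` [fset n in iota 1 (rho x)]|).
  apply: fsubset_leq_card; apply/fsubsetP => n /imfsetP[y /=].
  rewrite !inE /= mem_iota => /andP[_ yx] ->.
  by rewrite (rho_gt0 rk) /= add1n ltnS.
by rewrite card_fseq (leq_trans (size_undup _))// size_iota.
Qed.

Lemma position_le_card A x : position A x <= #|` slice A x|.
Proof. by apply: fsubset_leq_card; apply: fset_sub. Qed.

Lemma position_inj A x y : x \in A -> y \in A -> cls x y ->
  position A x = position A y -> x = y.
Proof.
wlog xy : x y / rho x <= rho y.
  move=> W xA yA cxy e; case: (leqP (rho x) (rho y)) => h; first exact: W.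
  by apply/esym/W => //; [exact: ltnW|exact: cls_sym].
move=> xA yA cxy e; apply: (rho_inj rk cxy); apply/eqP; rewrite eqn_leq xy /=.
have sub : [fset z in slice A x | rho z <= rho x] `<=`
    [fset z in slice A y | rho z <= rho y].
  apply/fsubsetP => z; rewrite !inE (cls_left cxy) => /andP[-> /= h].
  exact: leq_trans h xy.
have /fsetP/(_ y) : [fset z in slice A x | rho z <= rho x] =
    [fset z in slice A y | rho z <= rho y].
  by apply/eqP; rewrite eqEfcard sub -/(position A x) e /position leqnn.
by rewrite !inE yA cxy clsxx leqnn.
Qed.

(** The positions of the points of A in a class are pairwise distinct and
    bounded by their number, so by counting they fill an initial segment. *)
Lemma in_compress A x : (x \in compress A) = (rho x <= #|` slice A x|).
Proof.
apply/idP/idP => [/imfsetP[a /= aA ->]|le].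
  have [ca ->] := point_of_rankP a (position_gt0 aA).
  by rewrite -(slice_eq _ ca) position_le_card.
have eqpos : [fset position A a | a in slice A x] =
    [fset n in iota 1 #|` slice A x|].
  apply/eqP; rewrite eqEfcard; apply/andP; split.
    apply/fsubsetP => n /imfsetP[a /= aS ->]; rewrite !inE /= mem_iota.
    move: aS; rewrite in_slice => /andP[aA xa].
    by rewrite position_gt0//= add1n ltnS (slice_eq _ xa) position_le_card.
  rewrite card_fseq undup_id ?iota_uniq// size_iota.
  suff -> : #|` [fset position A a | a in slice A x]| = #|` slice A x| by [].
  apply: card_in_imfset => a b.
  rewrite !in_slice => /andP[aA xa] /andP[bA xb]; apply: position_inj => //.
  by rewrite -(cls_left xa).
have : rho x \in [fset n in iota 1 #|` slice A x|].
  by rewrite !inE /= mem_iota (rho_gt0 rk) /= add1n ltnS.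
rewrite -eqpos => /imfsetP[a /=]; rewrite in_slice => /andP[aA xa] e.
apply/imfsetP; exists a => //=.
have [ca ra] := point_of_rankP a (position_gt0 aA).
by apply: (rho_inj rk); [rewrite (cls_left xa)|rewrite ra].
Qed.

Lemma compress_closed A x y :
  x \in compress A -> cls x y -> rho y <= rho x -> y \in compress A.
Proof.
by rewrite !in_compress => xA /slice_eq <- /leq_trans; apply.
Qed.

Let point_of_rank_inj A :
  {in A &, injective (fun x => point_of_rank x (position A x))}.
Proof.
move=> x y xA yA /= e.
have [cx rx] := point_of_rankP x (position_gt0 xA).
have [cy ry] := point_of_rankP y (position_gt0 yA).
apply: (position_inj xA yA); last by rewrite -rx e ry.
by rewrite (cls_left cx) e; exact: cls_sym.
Qed.

Lemma card_compress A : #|` compress A| = #|` A|.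
Proof. by rewrite card_in_imfset//=; exact: point_of_rank_inj. Qed.

Lemma compress_mono A B : A `<=` B -> compress A `<=` compress B.
Proof.
move=> /fsubsetP AB; apply/fsubsetP => x; rewrite !in_compress => /leq_trans.
apply; apply: fsubset_leq_card; apply/fsubsetP => y.
by rewrite !in_slice => /andP[/AB -> ->].
Qed.

Variable Phi : T -> nat.
Hypothesis Phi_lt : forall x y, cls x y -> rho x < rho y -> Phi x < Phi y.

Let point_of_rank_case A x : x \in A ->
  point_of_rank x (position A x) = x \/
  Phi (point_of_rank x (position A x)) < Phi x.
Proof.
move=> xA; have [cx rx] := point_of_rankP x (position_gt0 xA).
have := position_le_rho A x; rewrite leq_eqVlt => /predU1P[e|lt].
  by left; apply/esym/(rho_inj rk cx); rewrite rx.
by right; apply: Phi_lt; [exact: cls_sym|rewrite rx].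
Qed.

Lemma sum_compress_le A :
  \sum_(x <- compress A) Phi x <= \sum_(x <- A) Phi x.
Proof.
rewrite big_imfset /=; last exact: point_of_rank_inj.
rewrite big_seq [leqRHS]big_seq; apply: leq_sum => x xA.
by case: (point_of_rank_case xA) => [->//|/ltnW].
Qed.

(** Each point either stays or strictly loses energy. *)
Lemma sum_compress_eq A :
  \sum_(x <- compress A) Phi x = \sum_(x <- A) Phi x -> compress A = A.
Proof.
rewrite big_imfset /=; last exact: point_of_rank_inj.
move=> e; suff fixA x : x \in A -> point_of_rank x (position A x) = x.
  by rewrite -[RHS]imfset_id; apply: eq_in_imfset.
move=> xA; case: (point_of_rank_case xA) => // lt; exfalso; move: e.
rewrite (big_fsetD1 x)//= [RHS](big_fsetD1 x)//= => /eqP.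
rewrite ltn_eqF// -addSn leq_add//.
rewrite big_seq [leqRHS]big_seq; apply: leq_sum => y; rewrite !inE => /andP[_ yA].
by case: (point_of_rank_case yA) => [->//|/ltnW].
Qed.

End Compress.

Section Iterate.
Local Open Scope nat_scope.
Local Open Scope fset_scope.
Variables (T : choiceType) (Phi : T -> nat).

(** All that the limit argument uses of a single rearrangement step. *)
Record compression (C : {fset T} -> {fset T}) : Prop := Compression {
  compression_mono : forall A B, A `<=` B -> C A `<=` C B;
  compression_card : forall A, #|` C A| = #|` A|;
  compression_le : forall A, \sum_(x <- C A) Phi x <= \sum_(x <- A) Phi x;
  compression_eq : forall A,
    \sum_(x <- C A) Phi x = \sum_(x <- A) Phi x -> C A = A }.

Variable C : nat -> {fset T} -> {fset T}.
Hypothesis compC : forall k, compression (C k).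

Fixpoint iter_seq (k : nat) (A : {fset T}) : {fset T} :=
  if k is k'.+1 then C k' (iter_seq k' A) else A.

Lemma iter_seq_mono k A B : A `<=` B -> iter_seq k A `<=` iter_seq k B.
Proof. by move=> AB; elim: k => //= k; exact: compression_mono. Qed.

Lemma iter_seq_card k A : #|` iter_seq k A| = #|` A|.
Proof. by elim: k => //= k IH; rewrite (compression_card (compC k)). Qed.

(** The common part of A and B is compressed into both compressed sets. *)
Lemma iter_seq_cardI k A B :
  #|` A `&` B| <= #|` iter_seq k A `&` iter_seq k B|.
Proof.
rewrite -(iter_seq_card k (A `&` B)); apply: fsubset_leq_card.
by rewrite fsubsetI !iter_seq_mono// ?fsubsetIl ?fsubsetIr.
Qed.

Let weight k A := \sum_(x <- iter_seq k A) Phi x.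

Let weight_anti A k l : k <= l -> weight l A <= weight k A.
Proof.
move=> kl; rewrite -(subnK kl); elim: (l - k) => // n IH.
by rewrite addSn; apply: leq_trans IH; exact: compression_le.
Qed.

Let weight_const A K L : weight K A = weight L A -> K <= L ->
  forall k, K <= k -> k <= L -> iter_seq k A = iter_seq K A.
Proof.
move=> e KL; elim=> [|k IH]; first by rewrite leqn0 => /eqP ->.
rewrite leq_eqVlt ltnS => /predU1P[<-//|Kk] kL.
rewrite -(IH Kk (ltnW kL)) /=; apply: (compression_eq (compC k)).
apply/eqP; rewrite eqn_leq (compression_le (compC k)) /=.
by apply: (leq_trans (weight_anti A Kk)); rewrite e; exact: (weight_anti A kL).
Qed.

(** The total energy is a nonincreasing sequence of natural numbers, and a set
    that keeps its energy is fixed. *)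
Lemma iter_seq_stable A :
  exists K, forall k, K <= k -> iter_seq k A = iter_seq K A.
Proof.
have [K HK] : exists K, forall k, weight K A <= weight k A.
  have ex : exists n, (fun n => `[< exists k, weight k A = n >]) n.
    by exists (weight 0 A); apply/asboolP; exists 0.
  have [n /asboolP[K <-] Kmin] := ex_minnP ex; exists K => k.
  by apply: Kmin; apply/asboolP; exists k.
exists K => k Kk; apply: (@weight_const A K k) => //.
by apply/eqP; rewrite eqn_leq HK weight_anti.
Qed.

(** A uniform version over the finitely many subsets of A, which include all
    the higher level sets of a function when A is one of its level sets. *)
Lemma iter_seq_stable_sub A :
  exists K, forall k B, K <= k -> B `<=` A -> iter_seq k B = iter_seq K B.
Proof.
suff [K HK] : exists K, forall B, B \in (fpowerset A : seq {fset T}) ->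
    forall k, K <= k -> iter_seq k B = iter_seq K B.
  by exists K => k B Kk BA; apply: HK => //; rewrite fpowersetE.
elim: (fpowerset A : seq {fset T}) => [|B s [K HK]]; first by exists 0.
have [L HL] := iter_seq_stable B.
exists (maxn K L) => D; rewrite in_cons => /predU1P[->|Ds] k;
  rewrite geq_max => /andP[Kk Lk].
  by rewrite (HL k)// (HL (maxn K L))// leq_maxr.
by rewrite (HK D Ds k)// (HK D Ds (maxn K L))// leq_maxl.
Qed.

(** A set that comes back cannot have lost energy on the way. *)
Lemma iter_seq_return A K : iter_seq K A = A ->
  forall k, k < K -> C k A = A.
Proof.
move=> KA k kK; have e : weight 0 A = weight K A by rewrite /weight KA.
have h l : l <= K -> iter_seq l A = A by move=> lK; exact: (weight_const e).
by rewrite -[RHS](h k.+1)//= h// ltnW.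
Qed.

End Iterate.

(** * Level sets of admissible functions and of limits *)

(** Finitely many values stay away from t: the level t can be raised slightly
    without changing the level set. *)
Lemma seq_gap (R : realType) (T : eqType) (w : T -> R) (t : R) (s : seq T) :
  exists2 delta, 0 < delta & forall x, x \in s -> t < w x -> t + delta <= w x.
Proof.
elim: s => [|y s [d d0 IH]]; first by exists 1.
case: (ltP t (w y)) => ty; last first.
  exists d => // x; rewrite in_cons => /predU1P[->|/IH//].
  by rewrite ltNge ty.
exists (Num.min d (w y - t)); first by rewrite lt_min d0 subr_gt0.
move=> x; rewrite in_cons => /predU1P[-> _|xs tx].
  by rewrite -lerBrDl ge_min lexx orbT.
by rewrite -lerBrDl ge_min lerBrDl IH.
Qed.

Section LevelSets.
Variables (R : realType) (T : choiceType).
Implicit Types (u v w : T -> R).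

Definition level u (t : R) : {fset T} := fset_set [set x | t < u x].

Lemma in_level u t x : admissible u -> 0 < t -> (x \in level u t) = (t < u x).
Proof.
move=> [_ fin] t0; rewrite in_fset_set; last exact: fin.
by apply/idP/idP; rewrite inE.
Qed.

Lemma level_sub u s t : admissible u -> 0 < s -> s <= t ->
  (level u t `<=` level u s)%fset.
Proof.
move=> uA s0 st; apply/fsubsetP => x.
by rewrite !in_level//; [exact: le_lt_trans|exact: lt_le_trans st].
Qed.

Lemma admissible_gap u t : admissible u -> 0 < t ->
  exists2 delta, 0 < delta & forall x, t < u x -> t + delta <= u x.
Proof.
move=> uA t0; have [delta d0 Hd] := seq_gap u t (level u t).
by exists delta => // x tx; apply: Hd => //; rewrite in_level.
Qed.

Lemma admissible_bounded u : admissible u -> exists M, forall x, u x <= M.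
Proof.
move=> uA; have u0 := uA.1.
exists (1 + \sum_(x <- level u 1) u x) => x.
have S0 (s : {fset T}) : 0 <= \sum_(x <- s) u x by apply: sumr_ge0.
case: (ltP 1 (u x)) => h; last by apply: (le_trans h); rewrite lerDl.
rewrite (big_fsetD1 x) ?in_level//=.
by rewrite addrCA lerDl addr_ge0.
Qed.

Lemma esum_level u v s t : admissible u -> admissible v -> 0 < s -> 0 < t ->
  (\esum_(x in [set: T]) ((s < u x)%R%:R * (t < v x)%R%:R)%:E
     = (#|` (level u s `&` level v t)%fset|%:R : R)%:E)%E.
Proof.
move=> uA vA s0 t0.
rewrite (eq_esum (b := fun x =>
  if x \in [set` (level u s `&` level v t)%fset] then 1%:E else 0%E)); last first.
  move=> x _; rewrite mem_setE in_fsetI !in_level//.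
  by case: (s < u x); case: (t < v x); rewrite /= ?mulr1 ?mulr0.
rewrite -esum_mkcond esum_fset//.
by rewrite fsbig_finite//= set_fsetK sumEFin card_fset_sum1 natr_sum.
Qed.

End LevelSets.

(** If the tests s < a k, for s >= t, become independent of k together, then
    either a k exceeds some t > 0 in the long run, and a is eventually constant,
    or a tends to 0.  The first alternative holds whenever the limit passes a
    positive level, so no strict inequality is weakened in the limit. *)
Lemma lim_of_stable_levels (R : realType) (a : nat -> R) :
  (forall k, 0 <= a k) ->
  (forall t, 0 < t -> exists K, forall k, (K <= k)%N ->
     forall s, t <= s -> (s < a k) = (s < a K)) ->
  0 <= lim (a k @[k --> \oo]) /\
  (forall t K, 0 < t -> (forall k, (K <= k)%N -> (t < a k) = (t < a K)) ->
     (t < lim (a k @[k --> \oo])) = (t < a K)).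
Proof.
move=> a0 H.
have evc t K : 0 < t -> (forall k, (K <= k)%N ->
     forall s, t <= s -> (s < a k) = (s < a K)) -> t < a K ->
   forall k, (K <= k)%N -> a k = a K.
  move=> t0 HK tK k Kk; have tk : t < a k by rewrite (HK _ Kk).
  have := HK _ Kk (a k) (ltW tk); have := HK _ Kk (a K) (ltW tK).
  by rewrite !ltxx => /negbT; rewrite -leNgt => h1 /esym/negbT;
     rewrite -leNgt => h2; apply/eqP; rewrite eq_le h1 h2.
have cv : cvgn a.
  have [[t [K [t0 HK tK]]]|no] := pselect (exists t K, [/\ 0 < t,
     forall k, (K <= k)%N -> forall s, t <= s -> (s < a k) = (s < a K) & t < a K]).
    apply: (is_cvg_near_cst (a K)); exists K => // k /= Kk.
    exact: evc HK tK _ Kk.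
  apply: (cvgP (0 : R)); apply/cvgr0Pnorm_le => t t0.
  have [K HK] := H t t0; exists K => // k /= Kk.
  rewrite ger0_norm// leNgt HK//; apply/negP => tK; apply: no.
  by exists t, K.
split; first by apply: limr_ge => //; exists 0.
move=> t K t0 HK.
have [K' HK'] := H t t0.
have eK : (t < a K) = (t < a K').
  by rewrite -(HK (maxn K K')) ?leq_maxl// HK'// leq_maxr.
rewrite eK; case: (ltP t (a K')) => h.
  have -> // : lim (a k @[k --> \oo]) = a K'.
  apply: lim_near_cst => //; exists K' => // k /=.
  exact: evc HK' h _.
apply/negbTE; rewrite -leNgt; apply: limr_le => //; exists K' => // k /= Kk.
by rewrite leNgt HK'// -leNgt.
Qed.

(** A sequence of operators F k on functions that act on level sets by the
    compressions C k: pointwise convergence reduces to the stabilisation of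
    finite sets. *)
Section LiftedIteration.
Variables (R : realType) (T : choiceType) (Phi : T -> nat).
Variables (C : nat -> {fset T} -> {fset T}) (F : nat -> (T -> R) -> (T -> R)).
Hypothesis compC : forall k, compression Phi (C k).
Hypothesis liftF : forall k u, admissible u ->
  admissible (F k u) /\ forall t, 0 < t -> level (F k u) t = C k (level u t).
Variable U : nat -> T -> R.
Hypothesis U0 : admissible (U 0).
Hypothesis US : forall k, U k.+1 = F k (U k).

Lemma iterate_level k : admissible (U k) /\
  forall t, 0 < t -> level (U k) t = iter_seq C k (level (U 0) t).
Proof.
elim: k => [|k [IHa IHl]] //; rewrite US.
have [Fa Fl] := liftF k IHa; split => // t t0.
by rewrite Fl// IHl.
Qed.

Let ulim x := lim (U k x @[k --> \oo]).

Lemma limit_level : admissible ulim /\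
  forall t, 0 < t -> exists K, forall k, (K <= k)%N ->
     level ulim t = iter_seq C k (level (U 0) t).
Proof.
have stab t : 0 < t -> exists K, forall k, (K <= k)%N -> forall x,
     forall s, t <= s -> (s < U k x) = (s < U K x).
  move=> t0; have [K HK] := iter_seq_stable_sub compC (level (U 0) t).
  exists K => k Kk x s ts; have s0 := lt_le_trans t0 ts.
  have [ak lk] := iterate_level k; have [aK lK] := iterate_level K.
  rewrite -!in_level// lk// lK// HK//.
  exact: level_sub.
have key x := @lim_of_stable_levels R (fun k => U k x)
   (fun k => (iterate_level k).1.1 x)
   (fun t t0 => let: ex_intro K HK := stab t t0 in
      ex_intro _ K (fun k Kk => HK k Kk x)).
have lv t : 0 < t -> exists K, forall k, (K <= k)%N ->
    forall x, (t < ulim x) = (x \in iter_seq C k (level (U 0) t)).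
  move=> t0; have [K HK] := stab t t0; exists K => k Kk x.
  have [ak lk] := iterate_level k.
  have [_ kx] := key x.
  by rewrite -lk// in_level// HK// (kx t K)// => k' Kk'; rewrite HK.
have adm : admissible ulim.
  split=> [x|t t0]; first exact: (key x).1.
  have [K HK] := lv t t0.
  rewrite (_ : mkset _ = [set` iter_seq C K (level (U 0) t)])//.
  by apply/seteqP; split=> x /=; rewrite (HK K).
split=> // t t0; have [K HK] := lv t t0; exists K => k Kk.
by apply/fsetP => x; rewrite in_level// (HK k).
Qed.

End LiftedIteration.

Section NthLargest.
Variables (R : realType) (T : choiceType).

Lemma nth_largest_ge0 (D : set T) (w : T -> R) n :
  (forall x, 0 <= w x) -> 0 <= nth_largest D w n.
Proof.
move=> w0; rewrite /nth_largest; set S := [set _ | _ in _].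
have S0 y : S y -> 0 <= y.
  move=> [Om _ <-]; have [ne|/set0P/negP] := pselect ((w @` [set` Om]) !=set0).
    by apply: lb_le_inf => // _ [x _ <-].
  by rewrite negbK => /eqP ->; rewrite inf0.
have [hs|/sup_out ->//] := pselect (has_sup S).
have [y Sy] := hs.1.
by apply: (le_trans (S0 _ Sy)); apply: ub_le_sup => //; exact: hs.2.
Qed.

(** The minimum over a finite set is attained and the supremum is approached
    from below, so for strict comparisons both quantifiers become plain
    existence statements.  For t >= 0 the value 0 of an empty supremum is never
    counted. *)
Lemma nth_largest_gt (D : set T) (w : T -> R) (n : nat) (t : R) :
  (forall x, 0 <= w x) -> (exists M, forall x, w x <= M) ->
  (0 < n)%N -> 0 <= t ->
  t < nth_largest D w n <->
  exists Om : {fset T}, [/\ [set` Om] `<=` D, #|` Om| = n &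
     forall x, x \in Om -> t < w x].
Proof.
move=> w0 [M wM] n0 t0; rewrite /nth_largest; set S := [set _ | _ in _].
have lb (Om : {fset T}) : has_lbound (w @` [set` Om]).
  by exists 0 => _ [x _ <-].
have ne (Om : {fset T}) : #|` Om| = n -> exists x, x \in Om.
  by move=> e; apply/fset0Pn; rewrite -cardfs_gt0 e.
have ub : has_ubound S.
  exists M => _ [Om [_ /ne[x xO]] <-]; apply: le_trans (wM x).
  by apply: ge_inf => //; exists x.
split=> [|[Om [OD On tO]]].
  move=> tS; have [nS|/set0P/negP] := pselect (S !=set0); last first.
    rewrite negbK => /eqP S0; move: tS; rewrite S0 sup0 => /lt_le_trans/(_ t0).
    by rewrite ltxx.
  have [_ [Om [OD On] <-] tO] := sup_gt nS tS.
  exists Om; split=> // x xO; apply: (lt_le_trans tO).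
  by apply: ge_inf => //; exists x.
apply: (@lt_le_trans _ _ (inf (w @` [set` Om]))); last first.
  by apply: ub_le_sup => //; exists Om.
have [d d0 Hd] := seq_gap w t Om.
apply: (@lt_le_trans _ _ (t + d)); first by rewrite ltrDl.
apply: lb_le_inf; first by have [x xO] := ne _ On; exists (w x); exists x.
by move=> _ [x xO <-]; apply: Hd => //; exact: tO.
Qed.

End NthLargest.

(** * Geometry of the rearrangement directions *)

Section Geometry.
Variable d : nat.
Implicit Types (x y f : 'rV[int]_d) (e : 'rV[rat]_d).

(** The weights d, d - 1, ..., 1 decrease strictly, so that tilt is positive on e_i,
    on e_i + e_j and on e_i - e_j for i < j. *)
Definition tilt f : int := \sum_(k < d) f 0 k * (d - k)%:Z.
Definition dot f x : int := \sum_(k < d) f 0 k * x 0 k.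
(** The factor 2 d makes the quadratic part dominate, while the tilt breaks the
    ties between the two points of a line at equal distance from its centre, in
    favour of the positive side, as the rank does. *)
Definition energyZ x : int := 2 * d%:Z * dot x x - tilt x.
Definition energy x : nat := `|energyZ x|%N.

Lemma dotC f x : dot f x = dot x f.
Proof. by apply: eq_bigr => k _; rewrite mulrC. Qed.

Lemma dot_line f x y m : dot f (x + m *: y) = dot f x + m * dot f y.
Proof.
rewrite /dot mulr_sumr -big_split /=; apply: eq_bigr => k _.
by rewrite !mxE; ring.
Qed.

Lemma dot_line_l f x y m : dot (x + m *: y) f = dot x f + m * dot y f.
Proof. by rewrite !(dotC _ f) dot_line. Qed.

Lemma tilt_line x y m : tilt (x + m *: y) = tilt x + m * tilt y.
Proof.
rewrite /tilt mulr_sumr -big_split /=; apply: eq_bigr => k _.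
by rewrite !mxE; ring.
Qed.

(** Coordinatewise, 2 d t^2 >= (d - k) t for every integer t. *)
Lemma energyZ_ge0 x : 0 <= energyZ x.
Proof.
rewrite /energyZ /dot /tilt mulr_sumr -sumrB; apply: sumr_ge0 => k _.
have kd : 0 <= (d - k)%:Z <= d%:Z by lia.
move: kd; set c := (d - k)%:Z; set X := x 0 k => /andP[c0 cd].
have XX : X <= X * X /\ 0 <= X * X by split; nia.
have : X * c <= (X * X) * c by apply: ler_wpM2r => //; case: XX.
have : (X * X) * c <= (X * X) * d%:Z by apply: ler_wpM2l => //; case: XX.
have : 0 <= (X * X) * d%:Z by apply: mulr_ge0 => //; case: XX.
by lia.
Qed.

Lemma energyZ_line x f m : energyZ (x + m *: f) =
  energyZ x + 2 * d%:Z * (m * m * dot f f + 2 * m * dot f x) - m * tilt f.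
Proof.
rewrite /energyZ tilt_line dot_line_l !dot_line (dotC x f).
by ring.
Qed.

Lemma dot_delta i x : dot (delta_mx 0 i) x = x 0 i.
Proof.
rewrite /dot (bigD1 i)//= mxE !eqxx mul1r big1 ?addr0// => k ki.
by rewrite mxE (negbTE ki) andbF mul0r.
Qed.

Lemma tilt_delta i : tilt (delta_mx 0 i) = (d - i)%:Z.
Proof.
rewrite /tilt (bigD1 i)//= mxE !eqxx mul1r big1 ?addr0// => k ki.
by rewrite mxE (negbTE ki) andbF mul0r.
Qed.

(** A common form for e_i (with N = 1) and (e_i + e_j) / 2, (e_i - e_j) / 2 (with
    N = 2): the primitive lattice vector f spans the lines, and e = f / |f|^2.
    The cofactor M makes M * dot f x the integer 2 * inner e x. *)
Record lattice_direction e f (N M : int) : Prop := LatticeDirection {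
  dir_scale : e = N%:~R^-1 *: map_mx intr f;
  dir_norm : dot f f = N;
  dir_NM : N * M = 2;
  dir_N0 : 0 < N;
  dir_unit : exists i, f 0 i = 1;
  dir_tilt : 0 < tilt f < 2 * d%:Z * N }.

Lemma directionP e : directions d e -> exists f N M, lattice_direction e f N M.
Proof.
case=> [[i ->]|[i [j [ij ee]]]].
  exists (delta_mx 0 i), 1, 2; split=> //.
  - by rewrite invr1 scale1r map_delta_mx.
  - by rewrite dot_delta mxE !eqxx.
  - by exists i; rewrite mxE !eqxx.
  - by rewrite tilt_delta; have := ltn_ord i; lia.
have [s [sE se]] : exists s : int, (s = 1 \/ s = -1) /\
    e = 2^-1 *: (unit_vec i + s%:~R *: unit_vec j).
  case: ee => ->; [exists 1|exists (-1)]; split; try by [left|right].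
    by rewrite scale1r.
  by rewrite mulrN1z scaleN1r.
have ji : (j == i) = false by apply/negbTE; rewrite -val_eqE /= gtn_eqF.
exists (delta_mx 0 i + s *: delta_mx 0 j), 2, 1; split=> //.
- by rewrite se map_mxD map_mxZ !map_delta_mx.
- rewrite dot_line_l !dot_delta !mxE !eqxx !(eq_sym i) ji /=.
  by case: sE => ->.
- by exists i; rewrite !mxE !eqxx (eq_sym i) ji /=; lia.
- rewrite tilt_line !tilt_delta; have := ltn_ord j; have := ltn_ord i.
  by case: sE => ->; lia.
Qed.

Definition rank_on_line e x : nat :=
  if inner e x <= 0 then Num.truncn (1 - 2 * inner e x)
  else Num.truncn (2 * inner e x).

Definition collinear e : rel 'rV[int]_d := fun x y => `[< parallel_class e x y >].

(** The order 0, 1, -1, 2, -2, ... on Z, and 1/2, -1/2, 3/2, ... on Z + 1/2,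
    written in terms of the doubled coordinate p. *)
Definition spiral (p : int) : nat := if p <= 0 then `|1 - p|%N else `|p|%N.

Section OneDirection.
Variables (e : 'rV[rat]_d) (f : 'rV[int]_d) (N M : int).
Hypothesis ef : lattice_direction e f N M.

Let p x : int := M * dot f x.

Let N0 : (N%:~R : rat) != 0.
Proof. by rewrite intr_eq0 gt_eqF// (dir_N0 ef). Qed.

Lemma inner2E x : 2 * inner e x = (p x)%:~R.
Proof.
have -> : inner e x = N%:~R^-1 * (dot f x)%:~R.
  rewrite /inner /dot rmorph_sum /= mulr_sumr; apply: eq_bigr => k _.
  by rewrite (dir_scale ef) !mxE rmorphM /= mulrA.
rewrite -[2]/(2%:~R) -(dir_NM ef) /p !rmorphM /=.
by field.
Qed.

Lemma p_line x m : p (x + m *: f) = p x + 2 * m.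
Proof. by rewrite /p dot_line (dir_norm ef) -(dir_NM ef); ring. Qed.

Lemma rank_spiral x : rank_on_line e x = spiral (p x).
Proof.
have E := inner2E x; rewrite /rank_on_line /spiral E.
have -> : (inner e x <= 0) = (p x <= 0).
  by rewrite -(ler_int rat) -E; apply/idP/idP; lra.
have trunc_abs (q : int) : 0 <= q -> Num.truncn (q%:~R : rat) = `|q|%N.
  by case: q => // n _; rewrite -pmulrn natrK.
case: ifP => h; last by rewrite trunc_abs//; lia.
by rewrite -[1]/(1%:~R) -rmorphB /= trunc_abs//; lia.
Qed.

(** A coordinate of f equal to 1 forces rational multiples of f between lattice
    points to be integral multiples. *)
Lemma parallelP x y : parallel_class e x y <-> exists m : int, y = x + m *: f.
Proof.
split=> [[c E]|[m ->]].
  have [i fi] := dir_unit ef.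
  exists (y 0 i - x 0 i); apply/rowP => k; rewrite !mxE.
  move: E; rewrite (dir_scale ef) scalerA => E.
  have Ek j : (x 0 j - y 0 j)%:~R = c * N%:~R^-1 * (f 0 j)%:~R :> rat.
    by have /rowP/(_ j) := E; rewrite !mxE.
  have ci : c * N%:~R^-1 = (x 0 i - y 0 i)%:~R by rewrite Ek fi mulr1.
  have := Ek k; rewrite ci -rmorphM /= => /eqP; rewrite eqr_int => /eqP.
  lia.
exists (- (m%:~R * N%:~R)); apply/rowP => k; rewrite (dir_scale ef) !mxE.
have -> : x 0 k - (x 0 k + m * f 0 k) = - (m * f 0 k) by ring.
by rewrite rmorphN rmorphM /=; field.
Qed.

Lemma collinearP x y : collinear e x y <-> exists m : int, y = x + m *: f.
Proof. by rewrite -parallelP; split=> [/asboolP|H]; last exact/asboolP. Qed.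

Lemma line_equiv : equivalence_rel (collinear e).
Proof.
have cs x y : collinear e x y -> collinear e y x.
  move=> /collinearP[m ->]; apply/collinearP; exists (- m).
  by rewrite scaleNr addrK.
have ct x y z : collinear e x y -> collinear e y z -> collinear e x z.
  move=> /collinearP[m ->] /collinearP[n ->]; apply/collinearP; exists (m + n).
  by rewrite scalerDl addrA.
move=> x y z; split; first by apply/collinearP; exists 0; rewrite scale0r addr0.
by move=> xy; apply/idP/idP; [exact/ct/cs|exact: ct].
Qed.

(** On a line the doubled coordinate p runs through one parity class, and
    exactly one of n and 1 - n, the two values of p of rank n, belongs to it. *)
Lemma line_ranked : ranked_classes (collinear e) (rank_on_line e).
Proof.
split; first exact: line_equiv.
- by move=> x; rewrite rank_spiral /spiral; case: ifP; lia.
- move=> x y /collinearP[m ->]; rewrite !rank_spiral p_line => h.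
  have -> : m = 0 by move: h; rewrite /spiral; case: ifP; case: ifP; lia.
  by rewrite scale0r addr0.
- move=> x n n0.
  have [m Hm] : exists m : int, spiral (p x + 2 * m) = n.
    have [m [Hm|Hm]] : exists m : int, p x + 2 * m = n%:Z \/ p x + 2 * m = 1 - n%:Z.
    (* With q = (p x + n) %/ 2, the candidates n - q and - q suit even and odd p x + n. *)
    + exists (if (p x + n%:Z)%R == 2 * ((p x + n%:Z) %/ 2)%Z
              then n%:Z - ((p x + n%:Z) %/ 2)%Z else - ((p x + n%:Z) %/ 2)%Z).
      by case: eqP; lia.
    + by exists m; rewrite Hm /spiral; case: ifP; lia.
    + by exists m; rewrite Hm /spiral; case: ifP; lia.
  exists (x + m *: f); split; first by apply/collinearP; exists m.
  by rewrite rank_spiral p_line.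
Qed.

(** Moving by m steps from x changes the energy by m (a (p x + m) - tilt f) with
    0 < tilt f < a.  Here p x + m is the sum of the coordinates of the two end
    points: when the rank increases it is at least 1 if m > 0 and at most 0 if
    m < 0. *)
Lemma energy_lt x y : collinear e x y ->
  (rank_on_line e x < rank_on_line e y)%N -> (energy x < energy y)%N.
Proof.
move=> /collinearP[m ->]; rewrite !rank_spiral p_line => h.
suff H : energyZ x < energyZ (x + m *: f).
  by have := energyZ_ge0 x; rewrite /energy; lia.
have -> : energyZ (x + m *: f) =
    energyZ x + m * (2 * d%:Z * N * (p x + m) - tilt f).
  rewrite energyZ_line (dir_norm ef) /p.
  have -> : 2 * m * dot f x = m * (N * M) * dot f x by rewrite (dir_NM ef); ring.
  by ring.
have /andP[t0 tN] := dir_tilt ef.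
move: t0 tN; set a := 2 * d%:Z * N => t0 tN; rewrite ltrDl.
have [m0|m0] : (1 <= m /\ 1 <= p x + m) \/ (m <= -1 /\ p x + m <= 0).
  by move: h; rewrite /spiral; case: ifP; case: ifP; lia.
- by apply: mulr_gt0; nia.
- by rewrite nmulr_lgt0; nia.
Qed.

Lemma compress_line : compression energy (compress (collinear e) (rank_on_line e)).
Proof.
split=> [A B|A|A|A].
- exact: compress_mono line_ranked _ _.
- exact: card_compress line_ranked _.
- exact: sum_compress_le line_ranked _ energy_lt _.
- exact: sum_compress_eq line_ranked _ energy_lt _.
Qed.

Lemma inner_inj_line x : {in parallel_class e x &, injective (inner e)}.
Proof.
move=> y z; rewrite !inE => /parallelP[m ->] /parallelP[n ->] E.
have : p (x + m *: f) = p (x + n *: f).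
  by apply/eqP; rewrite -(eqr_int rat) -!inner2E E.
by rewrite !p_line => h; have -> : m = n by lia.
Qed.

Lemma rank_toward_center x y :
  `|inner e y| < `|inner e x| \/ inner e y = `|inner e x| ->
  (rank_on_line e y <= rank_on_line e x)%N.
Proof.
move=> H; rewrite !rank_spiral.
have {H} : `|p y| < `|p x| \/ p y = `|p x|.
  case: H => H; [left|right].
    by rewrite -(ltr_int rat) !intr_norm -!(inner2E) !normrM ltr_pM2l.
  by apply/eqP; rewrite -(eqr_int rat) intr_norm -!(inner2E) H normrM.
by rewrite /spiral; case: ifP; case: ifP; lia.
Qed.

End OneDirection.
End Geometry.

(** * Level sets of the Schwarz rearrangement *)

Section StepLevel.
Variables (R : realType) (d : nat).
Implicit Types (u v : 'rV[int]_d -> R) (e : 'rV[rat]_d).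

Definition line_compress e := compress (collinear e) (rank_on_line e).

(** The value at x is the n-th largest on its line, n being the rank of x, and
    it exceeds t exactly when at least n points of the line do.  The transport to
    inner e @` V and back by pinv_ is undone using the injectivity of inner e on
    the line. *)
Lemma rearr_step_gt e u x t : directions d e -> admissible u -> 0 < t ->
  (t < rearr_step e u x) = (x \in line_compress e (level u t)).
Proof.
move=> /directionP[f [N [M ef]]] uA t0.
rewrite (in_compress (line_ranked ef)).
set V := parallel_class e x; pose g := pinv_ (fun=> 0) V (inner e).
have gK : {in V, cancel (inner e) g} by exact/pinvKV/(inner_inj_line ef).
have -> : rearr_step e u x =
    nth_largest (inner e @` V) (u \o g) (rank_on_line e x).
  by rewrite /rearr_step /rearr1 /rank_on_line /=; case: ifP.
have inV y : (collinear e x y) = (y \in V).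
  by apply/idP/idP => [/asboolP ?|/set_mem ?]; [exact/mem_set|exact/asboolP].
have Hgt := @nth_largest_gt R _ (inner e @` V) (u \o g) (rank_on_line e x) t
   (fun s => uA.1 (g s)).
have {Hgt} Hgt := Hgt _ (rho_gt0 (line_ranked ef) x) (ltW t0).
apply/idP/idP => [/Hgt|h].
  case; first by have [B HB] := admissible_bounded uA; exists B => s; exact: HB.
  move=> Om [OV <- Ot].
  have injg : {in Om &, injective g}.
    move=> s1 s2 /OV[y1 /mem_set y1V <-] /OV[y2 /mem_set y2V <-].
    by rewrite !gK// => ->.
  have <- : #|` [fset g s | s in Om]%fset| = #|` Om| by exact: card_in_imfset.
  apply: fsubset_leq_card; apply/fsubsetP => y /imfsetP[s /= sO ->].
  rewrite in_slice in_level// Ot// inV.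
  by have [z /mem_set zV <-] := OV _ sO; rewrite gK.
apply/Hgt; first by have [B HB] := admissible_bounded uA; exists B => s; exact: HB.
set S := slice _ _ _ in h.
pose Z := [fset y in take (rank_on_line e x) (enum_fset S)]%fset.
have ZS y : y \in Z -> y \in S by rewrite !inE /= => /mem_take; rewrite !inE.
have SV y : y \in S -> y \in V by rewrite in_slice inV => /andP[].
exists [fset inner e y | y in Z]%fset; split.
- move=> s /= /imfsetP[y /= /ZS/SV yV ->]; exists y => //; exact: set_mem.
- have -> : #|` [fset inner e y | y in Z]%fset| = #|` Z|.
    apply: card_in_imfset => y z /ZS/SV yV /ZS/SV zV.
    exact: (inner_inj_line ef yV zV).
  by rewrite /Z card_fseq undup_id ?take_uniq ?fset_uniq// size_takel.
- move=> s /imfsetP[y /= /ZS yS ->] /=; rewrite gK ?SV//.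
  by move: yS; rewrite in_slice in_level// => /andP[].
Qed.

Lemma rearr_step_level e u : directions d e -> admissible u ->
  admissible (rearr_step e u) /\
  forall t, 0 < t -> level (rearr_step e u) t = line_compress e (level u t).
Proof.
move=> eD uA; have adm : admissible (rearr_step e u).
  split=> [x|t t0].
    by rewrite /rearr_step /rearr1; case: ifP => _; apply: nth_largest_ge0 => s;
      exact: uA.1.
  rewrite (_ : mkset _ = [set` line_compress e (level u t)])//.
  by apply/seteqP; split=> x /=; rewrite rearr_step_gt.
split=> // t t0; apply/fsetP => x.
by rewrite in_level// rearr_step_gt.
Qed.

End StepLevel.

Section SchwarzLevel.
Variables (R : realType) (d : nat) (hd : (1 <= d)%N) (E : seq 'rV[rat]_d).
Hypothesis hE : enumerates_directions E.
Implicit Types (u v : 'rV[int]_d -> R).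

Let dirE e : (e \in E) <-> directions d e.
Proof. by case: hE => _ <-. Qed.

Let size_E : (0 < size E)%N.
Proof.
have : unit_vec (Ordinal hd) \in E by apply/dirE; left; exists (Ordinal hd).
by case: (E).
Qed.

Definition cyclic_compress (k : nat) := line_compress (nth 0 E (k %% size E)).

Let dir_nth k : directions d (nth 0 E (k %% size E)).
Proof. by apply/dirE/mem_nth; rewrite ltn_mod. Qed.

Lemma cyclic_compression k : compression (@energy d) (cyclic_compress k).
Proof. by have [f [N [M ef]]] := directionP (dir_nth k); exact: compress_line ef. Qed.

Lemma schwarz_level u : admissible u -> admissible (schwarz E u) /\
  forall t, 0 < t -> exists K, forall k, (K <= k)%N ->
    level (schwarz E u) t = iter_seq cyclic_compress k (level u t).
Proof.
move=> uA.
exact: (@limit_level R _ _ cyclic_compress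
  (fun k => rearr_step (nth 0 E (k %% size E))) cyclic_compression
  (fun k w wA => rearr_step_level (dir_nth k) wA)
  (fun k => rearr_iter E k u) uA (fun=> erefl)).
Qed.

Lemma schwarz_cardI u v s t : admissible u -> admissible v -> 0 < s -> 0 < t ->
  (#|` level u s `&` level v t| <=
     #|` level (schwarz E u) s `&` level (schwarz E v) t|)%fset%N.
Proof.
move=> uA vA s0 t0.
have [_ /(_ _ s0)[K HK]] := schwarz_level uA.
have [_ /(_ _ t0)[L HL]] := schwarz_level vA.
rewrite (HK (maxn K L)) ?leq_maxl// (HL (maxn K L)) ?leq_maxr//.
exact: iter_seq_cardI cyclic_compression _ _ _.
Qed.

Lemma schwarz_card u t : admissible u -> 0 < t ->
  #|` level (schwarz E u) t| = #|` level u t|.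
Proof.
move=> uA t0; have [_ /(_ _ t0)[K HK]] := schwarz_level uA.
by rewrite (HK K)// (iter_seq_card cyclic_compression).
Qed.

(** The iterates of a level set of u return to it, hence no compression moves
    it, and compressed sets contain with a point all points of lower rank on its
    line. *)
Lemma schwarz_fixed_closed u t e x y : admissible u -> schwarz E u = u ->
  0 < t -> directions d e -> collinear e x y ->
  (rank_on_line e y <= rank_on_line e x)%N -> t < u x -> t < u y.
Proof.
move=> uA uS t0 /[dup] eD /dirE eE exy ryx.
have [_ /(_ _ t0)[K HK]] := schwarz_level uA.
have [f [N [M ef]]] := directionP eD.
have fix_e : line_compress e (level u t) = level u t.
  have e_lt : (index e E < maxn K (size E))%N.
    by rewrite (leq_trans _ (leq_maxr _ _))// index_mem.
  have back : iter_seq cyclic_compress (maxn K (size E)) (level u t) = level u t.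
    by rewrite -HK ?leq_maxl// uS.
  have := iter_seq_return cyclic_compression back e_lt.
  by rewrite /cyclic_compress modn_small ?index_mem// nth_index.
rewrite -!(in_level _ uA t0) -fix_e => xA.
exact: (compress_closed (line_ranked ef) xA exy ryx).
Qed.

End SchwarzLevel.

(** * Superlevel sets of rearranged functions that reach far *)

Section Exhaustion.
Variable d : nat.
Implicit Types (x y z : 'rV[int]_d) (e : 'rV[rat]_d).

Lemma inner_unit i x : inner (unit_vec i) x = (x 0 i)%:~R.
Proof.
rewrite /inner (bigD1 i)//= mxE !eqxx mul1r big1 ?addr0// => k ki.
by rewrite mxE (negbTE ki) andbF mul0r.
Qed.

Lemma inner_lin (a b : rat) e e' x :
  inner (a *: (e + b *: e')) x = a * (inner e x + b * inner e' x).
Proof.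
rewrite /inner [b * _]mulr_sumr -big_split /= mulr_sumr; apply: eq_bigr => k _.
by rewrite !mxE; ring.
Qed.

Variable A : set 'rV[int]_d.
Hypothesis closedA : forall e x y, directions d e -> collinear e x y ->
  (rank_on_line e y <= rank_on_line e x)%N -> A x -> A y.

(** Moving towards the centre along a coordinate axis, or reflecting to the
    positive side. *)
Lemma axis_move x y j : A x -> (forall k, k != j -> y 0 k = x 0 k) ->
  `|y 0 j| < `|x 0 j| \/ y 0 j = `|x 0 j| -> A y.
Proof.
move=> Ax off on; have eD : directions d (unit_vec j) by left; exists j.
apply: (closedA eD _ _ Ax).
  apply/asboolP; exists (x 0 j - y 0 j)%:~R; apply/rowP => k; rewrite !mxE.
  have [->|kj] := eqVneq k j; first by rewrite !eqxx mulr1.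
  by rewrite (off k)// subrr andbF mulr0.
have [f [N [M ef]]] := directionP eD; apply: (rank_toward_center ef).
rewrite !inner_unit; case: on => [h|->]; [left|right]; last by rewrite intr_norm.
by rewrite -!intr_norm ltr_int.
Qed.

(** Only differences with i < j are directions; the sign tau compensates for
    the order of i and j. *)
Lemma diagonal_direction i j (s : int) : i != j -> s = 1 \/ s = -1 ->
  exists2 tau : rat, tau = 1 \/ tau = -1 &
    directions d ((tau / 2) *: (unit_vec i + (- s)%:~R *: unit_vec j)).
Proof.
move=> ij; have [lt|] := ltnP i j => [|ji] [->|->].
- exists 1; first by left.
  by right; exists i, j; split=> //; right; rewrite mul1r mulrN1z scaleN1r.
- exists 1; first by left.
  by right; exists i, j; split=> //; left; rewrite mul1r opprK scale1r.
- exists (-1); first by right.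
  right; exists j, i; split; first by rewrite ltn_neqAle eq_sym ij.
  right; rewrite mulN1r mulrN1z scaleN1r scaleNr -scalerN opprB; congr (_ *: _).
- exists 1; first by left.
  right; exists j, i; split; first by rewrite ltn_neqAle eq_sym ij.
  by left; rewrite mul1r opprK scale1r addrC.
Qed.

(** From (n, 0) in the coordinates i and j to (n - |c|, c): this is a move
    along e_i - e_j or e_i + e_j according to the sign of c, and for c <> 0 the
    distance to the centre of the line drops from n / 2 to |n - 2 |c|| / 2. *)
Lemma diagonal_move x y i j (c : int) : i != j -> A x -> x 0 j = 0 ->
  `|c| < x 0 i -> y 0 i = x 0 i - `|c| -> y 0 j = c ->
  (forall k, k != i -> k != j -> y 0 k = x 0 k) -> A y.
Proof.
move=> ij Ax xj cx yi yj off.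
have [c0|c0] := eqVneq c 0.
  have -> // : y = x; apply/rowP => k.
  have [->|kj] := eqVneq k j; first by rewrite yj c0 xj.
  have [->|ki] := eqVneq k i; first by rewrite yi c0 normr0 subr0.
  exact: off.
have [s sE sc] : exists2 s : int, s = 1 \/ s = -1 & c = s * `|c|.
  by case: (ltP 0 c) => h; [exists 1|exists (-1)]; lia.
have [tau tauE eD] := diagonal_direction ij sE.
apply: (closedA eD _ _ Ax).
  apply/asboolP; exists (2 / tau * `|c|%:~R); apply/rowP => k; rewrite !mxE /=.
  have tau0 : tau != 0 by case: tauE => ->.
  rewrite mulrA (_ : 2 / tau * `|c|%:~R * (tau / 2) = `|c|%:~R); last by field.
  have [->|kj] := eqVneq k j.
    by rewrite xj yj (eq_sym j) (negbTE ij) /= !add0r mulr1 {1}sc -rmorphM /=;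
      congr (_%:~R); ring.
  have [->|ki] := eqVneq k i.
    by rewrite yi mulr0 addr0 mulr1; congr (_%:~R); ring.
  by rewrite (off k)// subrr mulr0 addr0 mulr0.
have [f [N [M ef]]] := directionP eD; apply: (rank_toward_center ef); left.
rewrite !inner_lin !inner_unit !normrM ltr_pM2l; last first.
  by case: tauE => ->; rewrite ?normrN1 ?normr1 mul1r normr_gt0.
rewrite -!rmorphM -!rmorphD -!intr_norm ltr_int xj yi yj.
by case: sE => s1; move: sc cx c0; rewrite s1; lia.
Qed.

(** The coordinates of z are built one after the other, each being first
    cleared along its axis and then taken from the large coordinate i. *)
Lemma spread (i : 'I_d) z (s : seq 'I_d) : i \notin s -> forall x, A x ->
  \sum_(j <- s) `|z 0 j| < x 0 i ->
  A (\row_k if k == i then x 0 i - \sum_(j <- s) `|z 0 j|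
            else if k \in s then z 0 k else x 0 k).
Proof.
elim: s => [|j s IH] ins x Ax.
  rewrite big_nil subr0 => _; rewrite (_ : \row__ _ = x)//.
  by apply/rowP => k; rewrite mxE; case: eqP => // ->.
move: ins; rewrite in_cons negb_or => /andP[ij ins].
rewrite !big_cons => lt.
have s0 : 0 <= \sum_(j <- s) `|z 0 j| by apply: sumr_ge0.
pose x0 : 'rV[int]_d := \row_k if k == j then 0 else x 0 k.
have Ax0 : A x0.
  have [xj|xj] := eqVneq (x 0 j) 0.
    rewrite (_ : x0 = x)//; apply/rowP => k; rewrite mxE.
    by case: eqP => // ->; rewrite xj.
  apply: (axis_move (j := j) Ax) => [k kj|]; first by rewrite mxE (negbTE kj).
  by left; rewrite mxE eqxx normr0 normr_gt0.
pose x1 : 'rV[int]_d := \row_k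
  if k == i then x 0 i - `|z 0 j| else if k == j then z 0 j else x 0 k.
have Ax1 : A x1.
  apply: (@diagonal_move x0 x1 i j (z 0 j)) => //; rewrite ?mxE ?eqxx//.
  - by rewrite (negbTE ij) (le_lt_trans _ lt)// lerDl.
  - by rewrite (negbTE ij).
  - by rewrite (eq_sym j) (negbTE ij).
  - by move=> k ki kj; rewrite !mxE (negbTE ki) (negbTE kj).
have x1i : x1 0 i = x 0 i - `|z 0 j| by rewrite mxE eqxx.
have := IH ins x1 Ax1; rewrite x1i => H.
have {}H := H ltac:(by rewrite ltrBrDl).
(* Coordinate j of x1 is already the one of z, whether or not j occurs in s. *)
rewrite (_ : \row__ _ = (\row_k if k == i then
   x 0 i - `|z 0 j| - \sum_(j <- s) `|z 0 j|
   else if k \in s then z 0 k else x1 0 k))//.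
apply/rowP => k; rewrite !mxE in_cons; case: eqP => // _; first by rewrite opprD addrA.
by case: (k \in s); rewrite ?orbT// orbF; case: eqP => [->|].
Qed.

(** After making coordinate i positive and spreading, it is still larger than
    the required |z_i|, and a last axis move finishes. *)
Lemma closed_large x z i : A x -> \sum_j `|z 0 j| < `|x 0 i| -> A z.
Proof.
move=> Ax; rewrite (bigD1 i)//= -big_filter.
set s := seq.filter _ _ => lt.
have ins : i \notin s by rewrite mem_filter eqxx.
have ks k : (k \in s) = (k != i) by rewrite mem_filter mem_index_enum andbT.
have s0 : 0 <= \sum_(j <- s) `|z 0 j| by apply: sumr_ge0.
pose x0 : 'rV[int]_d := \row_k if k == i then `|x 0 i| else x 0 k.
have Ax0 : A x0.
  apply: (axis_move (j := i) Ax) => [k kj|]; first by rewrite mxE (negbTE kj).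
  by right; rewrite mxE eqxx.
have x0i : x0 0 i = `|x 0 i| by rewrite mxE eqxx.
have := @spread i z s ins x0 Ax0; rewrite x0i => H.
have {}H := H ltac:(by rewrite (le_lt_trans _ lt)// lerDr).
apply: (axis_move (j := i) H) => [k ki|]; first by rewrite mxE ks (negbTE ki).
left; rewrite mxE eqxx; move: lt; set S := \sum_(_ <- _) _ => lt.
have := ler_norm (`|x 0 i| - S); rewrite -ltrBrDr in lt; exact: lt_le_trans.
Qed.

End Exhaustion.

Lemma finite_box (d : nat) (M : nat) :
  finite_set [set x : 'rV[int]_d | forall i, `|x 0 i| <= M%:Z].
Proof.
pose g (w : 'rV['I_(M + M).+1]_d) : 'rV[int]_d := \row_k ((w 0 k)%:Z - M%:Z).
apply: (@sub_finite_set _ _ (g @` setT)); last exact/finite_image/finite_finset.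
move=> x /= xM; exists (\row_k inord (absz (x 0 k + M%:Z))) => //.
apply/rowP => k; rewrite !mxE; have := xM k => h.
by rewrite inordK; lia.
Qed.

(** * Functions with distinct values, and the Hardy-Littlewood inequality *)

Section StrictRange.
Variables (R : realType) (T : choiceType) (u : T -> R).
Hypotheses (uA : admissible u) (uS : strictly_decreasing_range u).

Let nth_gt n t : (0 < n)%N -> 0 <= t -> t < nth_largest setT u n <->
  exists Om : {fset T}, #|` Om| = n /\ forall x, x \in Om -> t < u x.
Proof.
move=> n0 t0; rewrite (nth_largest_gt setT uA.1 (admissible_bounded uA) n0 t0).
by split=> [[Om [_ ? ?]]|[Om [? ?]]]; exists Om.
Qed.

Lemma strict_range_infinite : infinite_set [set x | 0 < u x].
Proof.
move=> fin; pose B := fset_set [set x | 0 < u x].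
have pos : 0 < nth_largest setT u #|` B|.+1.
  by apply: le_lt_trans (uS _); [exact: nth_largest_ge0 uA.1|].
have [Om [cOm Opos]] := (nth_gt (ltn0Sn _) (lexx 0)).1 pos.
suff : (#|` Om| <= #|` B|)%N by rewrite cOm ltnn.
apply: fsubset_leq_card; apply/fsubsetP => x /Opos ux.
by rewrite in_fset_set// inE.
Qed.

(** If u x = u y is the common value of two points with n points above it, the
    values of index n + 1 and n + 2 coincide. *)
Lemma strict_range_inj x y : 0 < u x -> u x = u y -> x = y.
Proof.
move=> ux0 uxy; apply/eqP; apply: contraT => xy.
set n := #|` level u (u x)|.
have lt := uS (ltn0Sn n).
have an0 : 0 <= nth_largest setT u n.+2 by exact: nth_largest_ge0 uA.1.
have [Om [cOm Ogt]] := (nth_gt (ltn0Sn n) an0).1 lt.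
suff H : nth_largest setT u n.+2 < nth_largest setT u n.+2 by rewrite ltxx in H.
have [xt|tx] := leP (u x) (nth_largest setT u n.+2).
  suff : (#|` Om| <= n)%N by rewrite cOm ltnn.
  apply: fsubset_leq_card; apply/fsubsetP => z /Ogt uz.
  by rewrite in_level//; exact: le_lt_trans uz.
apply/(nth_gt (ltn0Sn _) an0); exists (x |` (y |` level u (u x)))%fset.
rewrite !cardfsU1 !inE !in_level// -uxy ltxx (negbTE xy) /=; split=> // z.
rewrite !inE in_level// => /or3P[/eqP->|/eqP->|] //; first by rewrite -uxy.
exact: lt_trans.
Qed.

End StrictRange.

(** If u z = 0, then closed_large confines every superlevel set, hence the
    whole set {u > 0}, to one box. *)
Lemma schwarz_fixed_pos (R : realType) (d : nat) (hd : (1 <= d)%N)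
    (E : seq 'rV[rat]_d) (hE : enumerates_directions E)
    (u : 'rV[int]_d -> R) : admissible u -> schwarz E u = u ->
  infinite_set [set x | 0 < u x] -> forall z, 0 < u z.
Proof.
move=> uA uS uinf z; rewrite ltNge; apply/negP => uz; apply: uinf.
apply: (sub_finite_set _ (finite_box d (absz (\sum_j `|z 0 j|)))) => x /= ux i.
have S0 : 0 <= \sum_j `|z 0 j| by apply: sumr_ge0.
rewrite gez0_abs// leNgt; apply/negP => xi.
have half : 0 < u x / 2 by rewrite divr_gt0.
have /(_ _ _ xi) H := @closed_large d [set y | u x / 2 < u y] _ x z i.
have : u x / 2 < u z.
  apply: H => [e a b eD ab rba /=|/=].
    exact: (schwarz_fixed_closed hd hE uA uS half eD ab rba).
  by rewrite ltr_pdivrMr// ltr_pMr// ltr1n.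
by move/lt_le_trans/(_ uz)/(lt_trans half); rewrite ltxx.
Qed.

(** Only finitely many values exceed c / 2; seq_gap applied to - u handles
    these. *)
Lemma admissible_gap_below (R : realType) (T : choiceType) (u : T -> R) (c : R) :
  admissible u -> 0 < c ->
  exists2 s, 0 < s < c & forall x, s < u x -> c <= u x.
Proof.
move=> uA c0; have c2 : 0 < c / 2 by rewrite divr_gt0.
have [delta d0 Hd] := seq_gap (fun x => - u x) (- c) (level u (c / 2)).
exists (Num.max (c / 2) (c - delta)).
  by rewrite lt_max c2 gt_max gtrBl d0 ltr_pdivrMr// ltr_pMr// ltr1n.
move=> x; rewrite gt_max => /andP[cx dx]; rewrite leNgt; apply/negP => xc.
have := Hd x; rewrite in_level// ltrN2 => /(_ cx xc); rewrite lerNr opprD opprK.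
by move=> h; have := lt_le_trans dx h; rewrite ltxx.
Qed.

(** The level sets at u x and just below u x differ by the single point x. *)
Lemma level_separates (R : realType) (T : choiceType) (u : T -> R)
    (B B' : {fset T}) (x : T) : admissible u -> 0 < u x ->
  (forall y, u x = u y -> x = y) -> (x \in B) != (x \in B') ->
  exists2 s, 0 < s &
    (#|` level u s `&` B| != #|` level u s `&` B'|)%fset.
Proof.
move=> uA ux0 uinj xBB'; apply: contrapT => no.
have eqc s : 0 < s -> (#|` level u s `&` B| = #|` level u s `&` B'|)%fset.
  by move=> s0; apply/eqP; apply: contraT => ne; exfalso; apply: no; exists s.
have [s /andP[s0 sux] sgap] := admissible_gap_below uA ux0.
have levs : level u s = (x |` level u (u x))%fset.
  apply/fsetP => y; rewrite !inE !in_level//; apply/idP/orP.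
    move=> /sgap; rewrite le_eqVlt => /predU1P[/uinj->|]; last by right.
    by left; rewrite eqxx.
  by case=> [/eqP->//|]; exact: lt_trans.
have step D : #|` (level u s `&` D)%fset| =
      ((x \in D) + #|` (level u (u x) `&` D)%fset|)%N.
  rewrite levs fsetIUl; case: (boolP (x \in D)) => xD.
    have -> : ([fset x] `&` D = [fset x])%fset.
      by apply/fsetP => y; rewrite !inE; case: eqP => // ->.
    by rewrite cardfsU1 !inE in_level// ltxx.
  suff -> : ([fset x] `&` D = fset0)%fset by rewrite fset0U.
  by apply/fsetP => y; rewrite !inE; case: eqP => // ->; rewrite (negbTE xD).
move: xBB'; have := eqc s s0; rewrite !step (eqc _ ux0) => /addIn.
by case: (x \in B); case: (x \in B').
Qed.

Theorem corollary5p12 (R : realType) (d : nat) (hd : (1 <= d)%N)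
    (E : seq 'rV[rat]_d) (hE : enumerates_directions E)
    (u v : 'rV[int]_d -> R) (hu : admissible u) (hv : admissible v) :
  (\esum_(x in [set: 'rV[int]_d]) (u x * v x)%:E
     <= \esum_(x in [set: 'rV[int]_d]) (schwarz E u x * schwarz E v x)%:E)%E
  /\
  (schwarz_fixed E u -> strictly_decreasing_range u ->
   (\esum_(x in [set: 'rV[int]_d]) (schwarz E u x * schwarz E v x)%:E
      < +oo)%E ->
   (\esum_(x in [set: 'rV[int]_d]) (u x * v x)%:E
      = \esum_(x in [set: 'rV[int]_d]) (schwarz E u x * schwarz E v x)%:E
    <-> v = schwarz E v)).
Proof.
have [u'A _] := schwarz_level hd hE hu.
have [v'A _] := schwarz_level hd hE hv.
set us := schwarz E u in u'A *; set vs := schwarz E v in v'A *.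
(* Slices are taken in v first and then in u, so that layer_cake_le applies twice. *)
have ind0 (w : 'rV[int]_d -> R) t x : 0 <= ((t < w x)%R%:R : R) by [].
have pair s t : 0 < s -> 0 < t ->
    (\esum_(x in setT) ((t < v x)%R%:R * (s < u x)%R%:R)%:E
       <= \esum_(x in setT) ((t < vs x)%R%:R * (s < us x)%R%:R : R)%:E)%E.
  move=> s0 t0; rewrite !esum_level// lee_fin ler_nat.
  exact: schwarz_cardI.
have slice_le t : 0 < t ->
    (\esum_(x in setT) (u x * (t < v x)%R%:R)%:E
       <= \esum_(x in setT) (us x * (t < vs x)%R%:R)%:E)%E.
  move=> t0; under eq_esum do rewrite mulrC.
  under [leRHS]eq_esum do rewrite mulrC.
  by apply: layer_cake_le; [exact: ind0|exact: hu.1|exact: ind0|exact: u'A.1|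
    move=> s s0; exact: pair].
split.
  by apply: layer_cake_le slice_le; [exact: hu.1|exact: hv.1|exact: u'A.1|exact: v'A.1].
move=> [_ uE] usr fin; split=> [eq_sum|vE]; last by rewrite /us uE -vE.
have upos := schwarz_fixed_pos hd hE hu uE (strict_range_infinite hu usr).
apply: contrapT => vne.
have [x vx] : exists x, v x != vs x.
  apply: contrapT => no; apply: vne; apply/funext => x; apply/eqP.
  by apply: contraT => vx; exfalso; apply: no; exists x.
(* The mean of two distinct nonnegative numbers is positive and separates them. *)
have [t0 t00 t0x] : exists2 t, 0 < t & (t < v x) != (t < vs x).
  have := hv.1 x; have := v'A.1 x; exists ((v x + vs x) / 2).
    by move: vx; rewrite neq_lt => /orP[] ?; lra.
  by move: vx; rewrite neq_lt => /orP[] ?; apply/negP => /eqP;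
    case: ltP; case: ltP => //; lra.
have [s0 s00 ne] : exists2 s, 0 < s &
    (#|` level u s `&` level v t0| != #|` level u s `&` level vs t0|)%fset.
  apply: (level_separates (x := x) hu (upos x)) => [y|].
    exact: strict_range_inj hu usr x y (upos x).
  by rewrite !in_level.
have {ne} lt_st : (#|` level u s0 `&` level v t0| <
    #|` level us s0 `&` level vs t0|)%fset%N.
  rewrite ltn_neqAle (schwarz_cardI hd hE)// andbT.
  by rewrite [in X in _ != X]/us uE.
have gap2 (f g : 'rV[int]_d -> R) t : admissible f -> admissible g -> 0 < t ->
    exists delta, [/\ 0 < delta, forall x, t < f x -> t + delta <= f x &
      forall x, t < g x -> t + delta <= g x].
  move=> fA gA tpos; have [d1 d10 H1] := admissible_gap fA tpos.
  have [d2 d20 H2] := admissible_gap gA tpos.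
  exists (Num.min d1 d2); split=> [|y ty|y ty]; first by rewrite lt_min d10.
    by apply: le_trans (H1 _ ty); rewrite lerD2l ge_min lexx.
  by apply: le_trans (H2 _ ty); rewrite lerD2l ge_min lexx orbT.
(* Since t0 * (t0 < vs y) <= vs y, an infinite slice would make the total infinite. *)
have slice_fin : (\esum_(x in setT) (us x * (t0 < vs x)%R%:R)%:E < +oo)%E.
  rewrite ltey; apply/eqP => slice_oo; move: fin; rewrite ltNge => /negP; apply.
  have <- : (t0%:E * (\esum_(x in setT) (us x * (t0 < vs x)%R%:R)%:E) = +oo)%E.
    by rewrite slice_oo gt0_muley ?lte_fin.
  rewrite -esumZl//; last by move=> y; rewrite lee_fin mulr_ge0 ?u'A.1.
  apply: le_esum => y _; rewrite -EFinM lee_fin mulrCA ler_wpM2l ?u'A.1//.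
  by case: ltP => h /=; rewrite ?mulr1 ?mulr0 ?v'A.1 ?ltW.
have [du [du0 gu gus]] := gap2 u us s0 hu u'A s00.
have [dv [dv0 gv gvs]] := gap2 v vs t0 hv v'A t00.
have slice_lt : (\esum_(x in setT) (u x * (t0 < v x)%R%:R)%:E
       < \esum_(x in setT) (us x * (t0 < vs x)%R%:R)%:E)%E.
  under eq_esum do rewrite mulrC.
  under [ltRHS]eq_esum do rewrite mulrC.
  apply: (layer_cake_lt _ _ _ _ _ s00 du0 gu gus).
  - exact: ind0.
  - exact: hu.1.
  - exact: ind0.
  - exact: u'A.1.
  - by move=> s spos; exact: pair.
  - under eq_esum do rewrite mulrC.
    under [ltRHS]eq_esum do rewrite mulrC.
    by rewrite !esum_level// lte_fin ltr_nat.
  - by under eq_esum do rewrite mulrC.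
suff : (\esum_(x in [set: 'rV[int]_d]) (u x * v x)%:E <
    \esum_(x in [set: 'rV[int]_d]) (us x * vs x)%:E)%E.
  by rewrite eq_sum ltxx.
apply: (layer_cake_lt _ _ _ _ slice_le t00 dv0 gv gvs slice_lt fin).
- exact: hu.1.
- exact: hv.1.
- exact: u'A.1.
- exact: v'A.1.
Qed.
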